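(* Let $A\subset(\mathbb Q\cup\{\infty\})^n$ be a finite set of vectors, and let $\mathbf x_1,\dots,\mathbf x_p,\mathbf y_1,\dots,\mathbf y_q\in(\mathbb Q\cup\{\infty\})^n$ be vectors such that $$A^\perp=\mathrm{Trophull}(\{\mathbf x_1,\dots,\mathbf x_p\})\quad\text{and}\quad A^{\perp\perp}=\mathrm{Trophull}(\{\mathbf y_1,\dots,\mathbf y_q\}).$$ Then the following three statements are equivalent. (1) There exist mutually complementary and orthogonal linear subspaces $P,Q$ of $\mathbb F^n$ such that $A^\perp=\mathrm{Trop}(P)$ and $A^{\perp\perp}=\mathrm{Trop}(Q)$ (in particular, $A^\perp$ and $A^{\perp\perp}$ are tropical linear varieties). (2) There exist liftings $\mathbf v_1,\dots,\mathbf v_p,\mathbf w_1,\dots,\mathbf w_q\in\mathbb F^n$ of the vectors $\mathbf x_1,\dots,\mathbf x_p,\mathbf y_1,\dots,\mathbf y_q$ respectively, such that $(\mathbf v_i,\mathbf w_j)=0$ for all $1\le i\le p$, $1\le j\le q$. (3) $A^\perp$ is a tropical linear variety.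
   Context: Write $\mathbb R_\infty=\mathbb R\cup\{\infty\}$, with $a<\infty$ and $a+\infty=\infty$ for $a\in\mathbb R$, and $\infty+\infty=\infty$. Tropical orthogonality: $\mathbf v=(v_1,\dots,v_n)$ and $\mathbf a=(a_1,\dots,a_n)$ in $\mathbb R_\infty^n$ are tropically orthogonal if among $v_1+a_1,\dots,v_n+a_n$ at least two are minimal (i.e. the minimum is attained for at least two indices; in particular $(\infty,\dots,\infty)$ is tropically orthogonal to every vector). For $X\subset\mathbb R_\infty^n$, $X^\perp$ is the set of all vectors in $\mathbb R_\infty^n$ tropically orthogonal to every element of $X$, and $X^{\perp\perp}=(X^\perp)^\perp$. Tropical linear hull: for a finite set $\{\mathbf a_1,\dots,\mathbf a_k\}\subset\mathbb R_\infty^n$, $\mathrm{Trophull}(\{\mathbf a_1,\dots,\mathbf a_k\})$ is the set of all vectors $\min_{1\le i\le k}\{t_i\mathbf 1_n+\mathbf a_i\}$ with $t_1,\dots,t_k\in\mathbb R_\infty$, where the minimum is component-wise and $\mathbf 1_n=(1,\dots,1)$. $\mathbb F=\overline{\mathbb Q}((t^{1/\infty}))$ is the field of formal Puiseux series in $t$ over $\overline{\mathbb Q}$; for $0\ne y\in\mathbb F$, $\mathrm{val}(y)\in\mathbb Q$ is the exponent of the lowest term of $y$, and $\mathrm{val}(0)=\infty$. Tropicalization: for $I\subset\{1,\dots,n\}$ let $D_I=\{x\in\mathbb F^n: x_i=0 \text{ for } i\in I,\ x_i\ne0\text{ for } i\notin I\}$. For $X\subset\mathbb F^n$, $\mathrm{Trop}(X\cap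 D_I)$ is the set of all $(y_1,\dots,y_n)\in\mathbb R_\infty^n$ such that $y_i=\infty$ for $i\in I$ and $(y_i)_{i\notin I}$ belongs to the Euclidean closure in $\mathbb R^{n-|I|}$ of $\{(\mathrm{val}(x_i))_{i\notin I}: x\in X\cap D_I\}$; and $\mathrm{Trop}(X)=\bigcup_I\mathrm{Trop}(X\cap D_I)$. A tropical linear variety is a set of the form $\mathrm{Trop}(P)$ for a linear subspace $P\subset\mathbb F^n$. A lifting of $\mathbf x\in(\mathbb Q\cup\{\infty\})^n$ is a vector $\mathbf v\in\mathbb F^n$ with $\mathrm{val}(v_i)=x_i$ for all $i$ (so $v_i=0$ exactly when $x_i=\infty$). $(\mathbf v,\mathbf w)=\sum_{i=1}^n v_iw_i$. Subspaces $P,Q\subset\mathbb F^n$ are orthogonal if $(\mathbf v,\mathbf w)=0$ for all $\mathbf v\in P$, $\mathbf w\in Q$; orthogonal subspaces are mutually complementary if $\dim P+\dim Q=n$, i.e. each is the orthogonal complement of the other with respect to this bilinear form. *)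

(* Defs.v *)
From HB Require Import structures.
From mathcomp Require Import all_boot all_order all_algebra.
From mathcomp Require Import algC lra.
From mathcomp Require Import all_classical all_reals all_analysis.

Set Implicit Arguments.
Unset Strict Implicit.
Unset Printing Implicit Defensive.

Import Order.TTheory GRing.Theory Num.Theory.
Import numFieldNormedType.Exports.

Local Open Scope classical_set_scope.
Local Open Scope ring_scope.

(** * The field K((t^(1/oo))) of Puiseux series over a field K *)

(* A series is given by its coefficient function: f q is the coefficient of
   t^q.  All exponents lie in (1/d)Z and are bounded below by b. *)
Definition psupport (K : fieldType) (d : nat) (b : rat) (f : rat -> K) : Prop :=
  forall q, f q != 0 -> (q * d%:R \is a Num.int) && (b <= q).

Record puiseux (K : fieldType) := Puiseux {
  pcoef :> rat -> K;
  pcoefP : exists2 d : nat, (0 < d)%N & exists b, psupport d b pcoef }.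

HB.instance Definition _ (K : fieldType) := gen_eqMixin (puiseux K).
HB.instance Definition _ (K : fieldType) := gen_choiceMixin (puiseux K).

(* Cauchy product; the sum has finite support when f and g are series. *)
Definition pconv (K : fieldType) (f g : rat -> K) (q : rat) : K :=
  \sum_(r \in [set: rat]) f r * g (q - r).

Section PuiseuxField.
Variable K : fieldType.
Implicit Types (f g h : rat -> K) (x y z : puiseux K) (d : nat) (b c q r : rat).

Lemma puiseux_ext x y : pcoef x =1 pcoef y -> x = y.
Proof.
case: x y => [f fP] [g gP] /= /funext fg; case: g / fg gP => gP.
by congr Puiseux; exact: Prop_irrelevance.
Qed.

Lemma psupportW d1 d2 b1 b2 f : (d1 %| d2)%N -> b2 <= b1 ->
  psupport d1 b1 f -> psupport d2 b2 f.
Proof.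
move=> /dvdnP[k ->] le_b fP q /fP /andP[qd bq].
by rewrite mulnC natrM mulrA rpredM ?natr_int // (le_trans le_b).
Qed.

Lemma pcoefP2 x y : exists2 d, (0 < d)%N &
  exists b, psupport d b x /\ psupport d b y.
Proof.
have [d1 d1_gt0 [b1 xP]] := pcoefP x; have [d2 d2_gt0 [b2 yP]] := pcoefP y.
exists (d1 * d2)%N; first by rewrite muln_gt0 d1_gt0.
exists (Num.min b1 b2); split.
  by apply: psupportW xP; rewrite ?dvdn_mulr // ge_min lexx.
by apply: psupportW yP; rewrite ?dvdn_mull // ge_min lexx orbT.
Qed.

Lemma pcoefP3 x y z : exists2 d, (0 < d)%N &
  exists b, [/\ psupport d b x, psupport d b y & psupport d b z].
Proof.
have [d1 d1_gt0 [b1 [xP yP]]] := pcoefP2 x y.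
have [d2 d2_gt0 [b2 zP]] := pcoefP z.
exists (d1 * d2)%N; first by rewrite muln_gt0 d1_gt0.
exists (Num.min b1 b2); split.
- by apply: psupportW xP; rewrite ?dvdn_mulr // ge_min lexx.
- by apply: psupportW yP; rewrite ?dvdn_mulr // ge_min lexx.
- by apply: psupportW zP; rewrite ?dvdn_mull // ge_min lexx orbT.
Qed.

Lemma pgrid d b c : (0 < d)%N -> exists2 s : seq rat, uniq s &
  forall r, (r \in s) = [&& r * d%:R \is a Num.int, b <= r & r <= c].
Proof.
move=> d_gt0; have dR : 0 < d%:R :> rat by rewrite ltr0n.
pose m := Num.floor (b * d%:R); pose N := Num.truncn (c * d%:R - m%:~R).
pose s0 := [seq (m%:~R + k%:R) / d%:R : rat | k <- iota 0 N.+1].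
exists (undup [seq r <- s0 | [&& r * d%:R \is a Num.int, b <= r & r <= c]]).
  exact: undup_uniq.
move=> r; rewrite mem_undup mem_filter andb_idr // => /and3P[rd br rc].
have mr : m%:~R <= r * d%:R.
  by apply: le_trans (floor_le_tmp _) _; rewrite ler_pM2r.
have : r * d%:R - m%:~R \is a Num.nat.
  by rewrite natrEint rpredB ?intr_int //= subr_ge0.
move=> /natrP[k kE]; apply/mapP; exists k; last first.
  by rewrite -kE addrC subrK mulfK ?gt_eqF.
rewrite mem_iota /= add0n ltnS /N truncn_ge_nat; last first.
  by rewrite subr_ge0 (le_trans mr) // ler_pM2r.
by rewrite -kE lerD2r ler_pM2r.
Qed.

Lemma pconvE f g q (s : seq rat) : uniq s ->
  (forall r, f r != 0 -> g (q - r) != 0 -> r \in s) ->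
  pconv f g q = \sum_(r <- s) f r * g (q - r).
Proof.
move=> us sP; rewrite fsbig_seq // /pconv.
apply/esym/fsbig_widen => // r [_ /= rs].
have [->|fr] := eqVneq (f r) 0; first by rewrite mul0r.
have [->|gr] := eqVneq (g (q - r)) 0; first by rewrite mulr0.
by case: rs; apply: sP.
Qed.

Lemma pconvP d b f g q : (0 < d)%N -> psupport d b f -> psupport d b g ->
  exists2 s, uniq s &
    (forall r, (r \in s) = [&& r * d%:R \is a Num.int, b <= r & r <= q - b]) /\
    pconv f g q = \sum_(r <- s) f r * g (q - r).
Proof.
move=> d_gt0 fP gP; have [s us sE] := pgrid b (q - b) d_gt0.
exists s => //; split=> //; apply: pconvE => // r /fP /andP[rd br] /gP /andP[_].
by rewrite sE rd br lerBrDl addrC -lerBrDl.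
Qed.

Lemma pconv_neq0 f g q : pconv f g q != 0 ->
  exists r, f r != 0 /\ g (q - r) != 0.
Proof.
move=> H; apply: contrapT => /forallNP H'; move/eqP: H; apply.
rewrite /pconv fsbig1 // => r _.
have [->|fr] := eqVneq (f r) 0; first by rewrite mul0r.
have [->|gr] := eqVneq (g (q - r)) 0; first by rewrite mulr0.
by case: (H' r).
Qed.

Lemma psupport_conv d b1 b2 f g :
  psupport d b1 f -> psupport d b2 g -> psupport d (b1 + b2) (pconv f g).
Proof.
move=> fP gP q /pconv_neq0[r [/fP/andP[rd br] /gP/andP[qd bq]]].
rewrite -[q](subrK r) addrC mulrDl rpredD //=; first by rewrite lerD.
Qed.

Lemma psupport_add d b f g :
  psupport d b f -> psupport d b g -> psupport d b (fun q => f q + g q).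
Proof.
move=> fP gP q; have [->|/fP//] := eqVneq (f q) 0.
by rewrite add0r => /gP.
Qed.

Lemma pcoefP_zero : exists2 d, (0 < d)%N & exists b, psupport d b (fun=> 0 : K).
Proof. by exists 1%N => //; exists 0 => q; rewrite eqxx. Qed.

Lemma pcoefP_one :
  exists2 d, (0 < d)%N & exists b, psupport d b (fun q => (q == 0)%:R : K).
Proof.
exists 1%N => //; exists 0 => q.
have [->|_] := eqVneq q 0; last by rewrite eqxx.
by rewrite mul0r rpred0 lexx.
Qed.

Lemma pcoefP_opp x :
  exists2 d, (0 < d)%N & exists b, psupport d b (fun q => - x q).
Proof.
have [d d_gt0 [b xP]] := pcoefP x; exists d => //; exists b => q.
by rewrite oppr_eq0 => /xP.
Qed.

Lemma pcoefP_add x y :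
  exists2 d, (0 < d)%N & exists b, psupport d b (fun q => x q + y q).
Proof.
have [d d_gt0 [b [xP yP]]] := pcoefP2 x y.
by exists d => //; exists b; exact: psupport_add.
Qed.

Lemma pcoefP_mul x y :
  exists2 d, (0 < d)%N & exists b, psupport d b (pconv x y).
Proof.
have [d d_gt0 [b [xP yP]]] := pcoefP2 x y.
by exists d => //; exists (b + b); exact: psupport_conv.
Qed.

Definition pzero := Puiseux pcoefP_zero.
Definition pone := Puiseux pcoefP_one.
Definition popp x := Puiseux (pcoefP_opp x).
Definition padd x y := Puiseux (pcoefP_add x y).
Definition pmul x y := Puiseux (pcoefP_mul x y).

Fact paddA : associative padd.
Proof. by move=> x y z; apply: puiseux_ext => q /=; rewrite addrA. Qed.
Fact paddC : commutative padd.
Proof. by move=> x y; apply: puiseux_ext => q /=; rewrite addrC. Qed.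
Fact padd0 : left_id pzero padd.
Proof. by move=> x; apply: puiseux_ext => q /=; rewrite add0r. Qed.
Fact paddN : left_inverse pzero popp padd.
Proof. by move=> x; apply: puiseux_ext => q /=; rewrite addNr. Qed.

HB.instance Definition _ :=
  GRing.isZmodule.Build (puiseux K) paddA paddC padd0 paddN.

Fact pmulC : commutative pmul.
Proof.
move=> x y; apply: puiseux_ext => q /=.
have [d d_gt0 [b [xP yP]]] := pcoefP2 x y.
have [s us [sE ->]] := pconvP q d_gt0 xP yP.
rewrite (@pconvE _ _ _ [seq q - r | r <- s]).
- by rewrite big_map; apply: eq_bigr => r _; rewrite subKr mulrC.
- by rewrite map_inj_uniq // => r1 r2 /addrI/oppr_inj.
- move=> r /yP/andP[rd br] /xP/andP[qd bq].
  apply/mapP; exists (q - r); last by rewrite subKr.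
  by rewrite sE qd bq lerD2l lerN2.
Qed.

Fact pmulA : associative pmul.
Proof.
move=> x y z; apply: puiseux_ext => q /=.
have [d d_gt0 [b [xP yP zP]]] := pcoefP3 x y z.
have [s1 us1 s1E] := pgrid (b + b) (q - b) d_gt0.
have [s2 us2 s2E] := pgrid b (q - (b + b)) d_gt0.
have xyP := psupport_conv xP yP; have yzP := psupport_conv yP zP.
have -> : pconv (pconv x y) z q = \sum_(r <- s1) pconv x y r * z (q - r).
  apply: pconvE => // r /xyP/andP[rd br] /zP/andP[_].
  by rewrite s1E rd br lerBrDl addrC -lerBrDl.
have -> : pconv x (pconv y z) q = \sum_(s <- s2) x s * pconv y z (q - s).
  apply: pconvE => // s /xP/andP[rd br] /yzP/andP[_].
  by rewrite s2E rd br lerBrDl addrC -lerBrDl.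
transitivity (\sum_(s <- s2) \sum_(r <- s1) x s * (y (r - s) * z (q - r))).
  apply: eq_big_seq => s; rewrite s2E => /and3P[sd bs sq].
  rewrite -mulr_sumr; congr (_ * _).
  rewrite (@pconvE _ _ _ [seq r - s | r <- s1]).
  - by rewrite big_map; apply: eq_bigr => r _; rewrite opprB addrA subrK.
  - by rewrite map_inj_uniq // => r1 r2 /addIr.
  - move=> u /yP/andP[ud bu] /zP/andP[_ bz].
    apply/mapP; exists (u + s); last by rewrite addrK.
    rewrite s1E mulrDl rpredD // lerD //=.
    by move: bz; lra.
rewrite exchange_big; apply: eq_big_seq => r; rewrite s1E => /and3P[rd br rq].
rewrite (@pconvE _ _ _ s2) //.
  by rewrite mulr_suml; apply: eq_bigr => s _; rewrite mulrA.
move=> s /xP/andP[sd bs] /yP/andP[_ brs].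
rewrite s2E sd bs /= opprD addrA.
have : s <= r - b by rewrite lerBrDl addrC -lerBrDl.
by move/le_trans; apply; rewrite lerD2r.
Qed.

Fact pmul1 : left_id pone pmul.
Proof.
move=> x; apply: puiseux_ext => q /=.
rewrite (@pconvE _ _ _ [:: 0]) //.
  by rewrite big_seq1 eqxx mul1r subr0.
by move=> r; rewrite inE; have [//|_] := eqVneq r 0; rewrite eqxx.
Qed.

Fact pmulDl : left_distributive pmul padd.
Proof.
move=> x y z; apply: puiseux_ext => q /=.
have [d d_gt0 [b [xP yP zP]]] := pcoefP3 x y z.
have [s us sE] := pgrid b (q - b) d_gt0.
have H f : psupport d b f ->
    pconv f z q = \sum_(r <- s) f r * z (q - r).
  move=> fP; apply: pconvE => // r /fP/andP[rd br] /zP/andP[_].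
  by rewrite sE rd br lerBrDl addrC -lerBrDl.
rewrite !H //; last exact: psupport_add.
by rewrite -big_split; apply: eq_bigr => r _; rewrite /= mulrDl.
Qed.

Fact pone_neq0 : pone != pzero.
Proof.
apply/eqP => /(congr1 (fun x => pcoef x 0)) /= /eqP.
by rewrite oner_eq0.
Qed.

HB.instance Definition _ := GRing.Zmodule_isComNzRing.Build (puiseux K)
  pmulA pmulC pmul1 pmulDl pone_neq0.

(* The lowest exponent of a nonzero series (see pordP); junk value 0 at 0. *)
Definition pord x : rat :=
  xget 0 [set q | x q != 0 /\ forall r, x r != 0 -> q <= r].

Lemma pordP x : x != 0 ->
  x (pord x) != 0 /\ forall r, x r != 0 -> pord x <= r.
Proof.
move=> x0.
apply: (@xgetPex _ 0 [set q | x q != 0 /\ forall r, x r != 0 -> q <= r]).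
have [q0 xq0] : exists q, x q != 0.
  apply: contrapT => /forallNP H; move/eqP: x0; apply; apply: puiseux_ext => q.
  by apply/eqP/negPn/negP/H.
have [d d_gt0 [b xP]] := pcoefP x.
have dR : 0 < d%:R :> rat by rewrite ltr0n.
have natP q : x q != 0 -> exists k : nat,
      q * d%:R - (Num.floor (b * d%:R))%:~R = k%:R.
  move=> /xP/andP[qd bq]; apply/natrP.
  rewrite natrEint rpredB ?intr_int //= subr_ge0.
  by apply: le_trans (floor_le_tmp _) _; rewrite ler_pM2r.
pose P (k : nat) := `[< exists2 q, x q != 0 &
  q * d%:R - (Num.floor (b * d%:R))%:~R = k%:R :> rat >].
have exP : exists k, P k.
  by have [k kE] := natP _ xq0; exists k; apply/asboolP; exists q0.
case: (ex_minnP exP) => k /asboolP[q xq qE] kmin; exists q; split=> // r xr.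
have [j jE] := natP _ xr.
have : (k <= j)%N by apply: kmin; apply/asboolP; exists r.
by rewrite -(ler_nat rat) -qE -jE lerD2r ler_pM2r.
Qed.

(* Inverse of a power series with constant coefficient a 0. *)
Fixpoint psinv_seq (a : nat -> K) (n : nat) : seq K :=
  if n is n'.+1 then
    let s := psinv_seq a n' in
    rcons s (- (a 0%N)^-1 * \sum_(i < n'.+1) a i.+1 * s`_(n' - i))
  else [:: (a 0%N)^-1].
Definition psinv a n := (psinv_seq a n)`_n.

Lemma size_psinv_seq a n : size (psinv_seq a n) = n.+1.
Proof. by elim: n => //= n IHn; rewrite size_rcons IHn. Qed.

Lemma nth_psinv_seq a m n : (m <= n)%N -> (psinv_seq a n)`_m = psinv a m.
Proof.
elim: n => [|n IHn]; first by rewrite leqn0 => /eqP->.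
rewrite leq_eqVlt => /predU1P[->//|]; rewrite ltnS => le_mn /=.
by rewrite nth_rcons size_psinv_seq ltnS le_mn IHn.
Qed.

Lemma psinvP (a : nat -> K) n : a 0%N != 0 ->
  \sum_(i < n.+1) a i * psinv a (n - i) = (n == 0%N)%:R.
Proof.
move=> a0; rewrite big_ord_recl subn0; case: n => [|n].
  by rewrite big_ord0 addr0 mulfV.
rewrite /= {1}/psinv /= nth_rcons size_psinv_seq ltnn eqxx mulNr mulrN mulrA.
rewrite mulfV // mul1r addrC; apply/eqP; rewrite subr_eq0; apply/eqP.
apply: eq_bigr => i _; congr (_ * _).
by rewrite nth_psinv_seq ?leq_subr // /bump leq0n add1n subSS.
Qed.

Lemma pinv_ex x : x != 0 -> exists y, y * x = 1.
Proof.
move=> x0; have [xv vmin] := pordP x0; set v := pord x in xv vmin.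
have [d d_gt0 [b xP]] := pcoefP x.
have dR : 0 < d%:R :> rat by rewrite ltr0n.
have dU : d%:R != 0 :> rat by rewrite gt_eqF.
have natP r : x r != 0 -> (r - v) * d%:R \is a Num.nat.
  move=> xr; rewrite natrEint mulr_ge0 ?subr_ge0 ?vmin // andbT.
  rewrite mulrBl rpredB //.
  - by case/andP: (xP _ xr).
  - by case/andP: (xP _ xv).
pose a k := x (v + k%:R / d%:R).
have a0 : a 0%N != 0 by rewrite /a mul0r addr0.
pose g r := let u := (r + v) * d%:R in
  if u \is a Num.nat then psinv a (Num.truncn u) else 0.
have gP : exists2 e : nat, (0 < e)%N & exists c, psupport e c g.
  exists (d * `|denq v|)%N; first by rewrite muln_gt0 d_gt0 absz_gt0 denq_eq0.
  exists (- v) => r; rewrite /g; case: ifPn => [ru _|_]; last by rewrite eqxx.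
  apply/andP; split; last first.
    by rewrite -subr_ge0 opprK -(pmulr_lge0 _ dR) natr_ge0.
  have -> : r = (r + v) - v by rewrite addrK.
  rewrite mulrBl rpredB // natrM.
    by rewrite mulrA rpredM ?natr_int ?intr_nat // intrEge0 ?natr_ge0.
  rewrite mulrCA rpredM ?natr_int //.
  by rewrite natr_absz ger0_norm ?denq_ge0 // -numqE intr_int.
exists (Puiseux gP); rewrite mulrC; apply: puiseux_ext => q /=.
have [qn|qn] := boolP (q * d%:R \is a Num.nat); last first.
  have -> : (q == 0) = false.
    by apply: contraNF qn => /eqP->; rewrite mul0r rpred0.
  apply/eqP/negPn/negP => /pconv_neq0[r [/natP rn]].
  rewrite /g; case: ifPn => [qrn _|_]; last by rewrite eqxx.
  move/negP: qn; apply.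
  have -> : q * d%:R = (q - r + v) * d%:R + (r - v) * d%:R.
    by rewrite -mulrDl; congr (_ * _); lra.
  exact: rpredD.
have [n nE] := natrP qn.
have qE : q = n%:R / d%:R by rewrite -nE mulfK.
have shiftI : injective (fun k : nat => v + k%:R / d%:R : rat).
  move=> i j /addrI /(mulIf _) H; apply/eqP; rewrite -(eqr_nat rat).
  by apply/eqP/H; rewrite invr_neq0.
rewrite (@pconvE _ _ _ [seq v + k%:R / d%:R | k <- iota 0 n.+1]).
- rewrite big_map -[iota 0 n.+1]/(index_iota 0 n.+1) big_mkord.
  have -> : (q == 0) = (n == 0)%N.
    by rewrite qE mulf_eq0 invr_eq0 (negPf dU) orbF pnatr_eq0.
  rewrite -(psinvP n a0); apply: eq_bigr => i _; congr (_ * _).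
  have -> : g (q - (v + i%:R / d%:R)) = g ((n - i)%:R / d%:R - v).
    rewrite natrB; last by rewrite -ltnS.
    by rewrite qE mulrBl opprD addrAC addrA addrAC.
  by rewrite /g subrK divfK // natr_nat natrK.
- by rewrite map_inj_uniq ?iota_uniq.
- move=> r /natP /natrP[k kE]; rewrite /g.
  case: ifPn => [qrn _|_]; last by rewrite eqxx.
  apply/mapP; exists k; last by rewrite -kE mulfK // addrC subrK.
  rewrite mem_iota /= add0n ltnS -(ler_nat rat) -kE -nE -subr_ge0 -mulrBl.
  by rewrite opprB addrA addrAC natr_ge0.
Qed.

Definition pinv x : puiseux K := xget 0 [set y | y * x = 1].

Fact pmulV x : x != 0 -> pinv x * x = 1.
Proof. by move=> /pinv_ex; apply: (@xgetPex _ 0 [set y | y * x = 1]). Qed.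

Fact pinv0 : pinv 0 = 0.
Proof.
rewrite /pinv; case: xgetP => // y _ /= /eqP.
by rewrite mulr0 eq_sym oner_eq0.
Qed.

HB.instance Definition _ :=
  GRing.ComNzRing_isField.Build (puiseux K) pmulV pinv0.

End PuiseuxField.

(* algC is an algebraic closure of the rationals. *)
Notation FF := (puiseux algC).

(** * Tropical notions, with R u {oo} encoded as \bar R minus -oo *)

Definition pval (R : realType) (x : FF) : \bar R :=
  if x == 0 then +oo%E else (ratr (pord x))%:E.

Definition Rinfty (R : realType) (n : nat) : set 'rV[\bar R]_n :=
  [set v : 'rV[\bar R]_n | forall i, v ord0 i != -oo%E].
Arguments Rinfty : clear implicits.

Definition Qinfty (R : realType) (n : nat) : set 'rV[\bar R]_n :=
  [set v : 'rV[\bar R]_n | forall i, v ord0 i = +oo%E \/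
             exists q : rat, v ord0 i = (ratr q)%:E].
Arguments Qinfty : clear implicits.

(* The minimum is attained at least twice.  For n >= 2 this already covers the
   first disjunct, which makes (oo, ..., oo) orthogonal to every vector also
   when n <= 1. *)
Definition trop_orth (R : realType) (n : nat) (v a : 'rV[\bar R]_n) : Prop :=
  (forall i, (v ord0 i + a ord0 i)%E = +oo%E) \/
  exists i j : 'I_n, [/\ i != j,
    forall k, (v ord0 i + a ord0 i <= v ord0 k + a ord0 k)%E &
    forall k, (v ord0 j + a ord0 j <= v ord0 k + a ord0 k)%E].

Definition trop_perp (R : realType) (n : nat) (X : set 'rV[\bar R]_n) :
    set 'rV[\bar R]_n :=
  [set v : 'rV[\bar R]_n | Rinfty R n v /\ forall a, X a -> trop_orth v a].

Definition trophull (R : realType) (n k : nat) (a : 'I_k -> 'rV[\bar R]_n) :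
    set 'rV[\bar R]_n :=
  [set v : 'rV[\bar R]_n | exists t : 'I_k -> \bar R,
     (forall i, t i != -oo%E) /\
     v = \row_j \big[Order.min/+oo%E]_(i < k) (t i + a i ord0 j)%E].

Definition Dstratum (n : nat) (I : {set 'I_n}) : set 'rV[FF]_n :=
  [set x : 'rV[FF]_n | forall i, (x ord0 i == 0) = (i \in I)].

(* The coordinates of y outside I, as a point of R^(n - #|I|). *)
Definition coords_out (R : realType) (n : nat) (I : {set 'I_n})
    (y : 'rV[\bar R]_n) : 'rV[R]_(#|~: I|) :=
  \row_k fine (y ord0 (enum_val k)).

Definition trop_stratum (R : realType) (n : nat) (X : set 'rV[FF]_n)
    (I : {set 'I_n}) : set 'rV[\bar R]_n :=
  [set y : 'rV[\bar R]_n | [/\ forall i, i \in I -> y ord0 i = +oo%E,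
               forall i, i \notin I -> y ord0 i \is a fin_num &
               closure [set coords_out I (map_mx (@pval R) x) |
                         x in X `&` Dstratum I] (coords_out I y)]].

Definition Trop (R : realType) (n : nat) (X : set 'rV[FF]_n) :
    set 'rV[\bar R]_n :=
  [set y : 'rV[\bar R]_n | exists I : {set 'I_n}, trop_stratum X I y].
Arguments Trop R {n} X.

Definition trop_linear_variety (R : realType) (n : nat)
    (Y : set 'rV[\bar R]_n) : Prop :=
  exists P : {vspace 'rV[FF]_n}, Y = Trop R [set` P].

Definition lifting (R : realType) (n : nat) (x : 'rV[\bar R]_n)
    (v : 'rV[FF]_n) : Prop :=
  forall i, pval R (v ord0 i) = x ord0 i.

Definition dotF (n : nat) (v w : 'rV[FF]_n) : FF := \sum_i v ord0 i * w ord0 i.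

Definition orthogonal_subspaces (n : nat) (P Q : {vspace 'rV[FF]_n}) :
    Prop :=
  forall v w, v \in P -> w \in Q -> dotF v w = 0.

Definition complementary_subspaces (n : nat) (P Q : {vspace 'rV[FF]_n}) :
    Prop :=
  orthogonal_subspaces P Q /\ (\dim P + \dim Q)%N = n.

(* Main.v *)
Require Import Defs.
From mathcomp Require Import all_boot all_order all_algebra.
From mathcomp Require Import algC lra.
From mathcomp Require Import all_classical all_reals all_analysis.

Set Implicit Arguments.
Unset Strict Implicit.
Unset Printing Implicit Defensive.

Import Order.TTheory GRing.Theory Num.Theory.
Import numFieldNormedType.Exports.

Local Open Scope classical_set_scope.
Local Open Scope ring_scope.

(** The heart of the matter is a lifting statement valid for every linear
    subspace P: a vector y with entries in Q u {oo} which is tropically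
    orthogonal to val(x) for all x in P is the valuation of some w in the
    orthogonal complement of P.  Linear algebra produces, for each finite
    coordinate i, some w orthogonal to P with val(w) >= y and equality at i; a
    generic combination of these has valuation exactly y, because the residue
    field is infinite of characteristic 0.  Genericity also gives
    Trophull(val v_1, ..., val v_k) <= Trop P for v_1, ..., v_k in P, while
    Trop P and Trop Q are tropically orthogonal for orthogonal P and Q: a
    minimum attained only once cannot cancel.

    (1) => (2): lift the x_i to P and the y_j to Q.  (2) => (3): take for P the
    orthogonal complement of the span of the w_j; then Trop P is squeezed
    between the hull of the x_i and the tropical complement of the y_j.
    (3) => (1): take for Q the orthogonal complement of P. *)

(** * Coefficients and lowest exponents of Puiseux series *)

Lemma pcoefD (K : fieldType) (x y : puiseux K) q : (x + y) q = x q + y q.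
Proof. by []. Qed.

Lemma pcoefN (K : fieldType) (x : puiseux K) q : (- x) q = - x q.
Proof. by []. Qed.

Lemma pcoef_nat (K : fieldType) m q :
  (m%:R : puiseux K) q = if q == 0 then m%:R else 0.
Proof.
elim: m => [|m IHm]; first by case: ifP.
by rewrite mulrS pcoefD IHm /=; case: eqP => _; rewrite ?addr0 // -mulrS.
Qed.

Lemma pord_eq (K : fieldType) (x : puiseux K) q :
  x q != 0 -> (forall r, x r != 0 -> q <= r) -> pord x = q.
Proof.
move=> xq qmin; have x0 : x != 0 by apply: contraNneq xq => ->.
by have [xo omin] := pordP x0; apply/le_anti; rewrite omin // qmin.
Qed.

Lemma pordM (K : fieldType) (x y : puiseux K) :
  x != 0 -> y != 0 -> pord (x * y) = pord x + pord y.
Proof.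
move=> x0 y0; have [xo xmin] := pordP x0; have [yo ymin] := pordP y0.
apply: pord_eq => [|r /pconv_neq0[s [/xmin xs /ymin ys]]]; last first.
  by move: (lerD xs ys); rewrite addrC [s + _]addrC subrK addrC.
(* Any other splitting of this exponent puts one factor below its lowest exponent, so the Cauchy
   product has a single term. *)
have -> : (x * y) (pord x + pord y) = x (pord x) * y (pord y).
  rewrite /= (@pconvE _ _ _ _ [:: pord x]) //.
    by rewrite big_seq1 addrAC subrr add0r.
  move=> r /xmin xr /ymin yr; rewrite inE eq_le xr andbT.
  by move: yr; lra.
by rewrite mulf_neq0.
Qed.

Lemma pcoefP_X (K : fieldType) (s : rat) : exists2 d, (0 < d)%N &
  exists b, psupport d b (fun q => (q == s)%:R : K).
Proof.
exists `|denq s|%N; first by rewrite absz_gt0 denq_eq0.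
exists s => q; have [->|_] := eqVneq q s; last by rewrite eqxx.
by rewrite lexx natr_absz ger0_norm ?denq_ge0 // -numqE intr_int.
Qed.

(** The monomial [t^s]; it realises an arbitrary rational as a valuation. *)
Definition pX (K : fieldType) (s : rat) : puiseux K := Puiseux (pcoefP_X K s).

(** * Valuations of sums and products, and generic combinations *)

Section Valuation.
Variable R : realType.
Local Open Scope ereal_scope.
Local Notation pval := (@pval R).
Implicit Types (x y : FF).

Lemma pval0 : pval 0%R = +oo. Proof. by rewrite /Defs.pval eqxx. Qed.

Lemma pval_neq0 x : (x != 0)%R -> pval x = (ratr (pord x))%:E.
Proof. by rewrite /Defs.pval => /negPf->. Qed.

Lemma pval_eqy x : (pval x == +oo) = (x == 0%R).
Proof. by rewrite /Defs.pval; case: ifP. Qed.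

Lemma pval_neqNy x : pval x != -oo.
Proof. by rewrite /Defs.pval; case: ifP. Qed.

Lemma pval_le_coef x q : x q != 0%R -> pval x <= (ratr q)%:E.
Proof.
move=> xq; have x0 : (x != 0)%R by apply: contraNneq xq => ->.
by rewrite pval_neq0 // lee_fin ler_rat (pordP x0).2.
Qed.

Lemma pvalE x q : x q != 0%R -> (forall r, x r != 0%R -> (q <= r)%R) ->
  pval x = (ratr q)%:E.
Proof.
move=> xq qmin; rewrite pval_neq0 ?(pord_eq xq) //.
by apply: contraNneq xq => ->.
Qed.

Lemma pvalX s : pval (pX _ s) = (ratr s)%:E.
Proof.
apply: pvalE => [|r] /=; first by rewrite eqxx oner_eq0.
by have [->//|_] := eqVneq r s; rewrite eqxx.
Qed.

Lemma pval_nat m : (0 < m)%N -> pval (m%:R)%R = 0.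
Proof.
move=> m0; rewrite (@pvalE _ 0%R) ?rmorph0 //.
  by rewrite pcoef_nat eqxx pnatr_eq0 -lt0n.
by move=> r; rewrite pcoef_nat; have [->//|_] := eqVneq r 0%R; rewrite eqxx.
Qed.

Lemma pvalN x : pval (- x)%R = pval x.
Proof.
have [->|x0] := eqVneq x 0%R; first by rewrite oppr0.
have [xo omin] := pordP x0; rewrite (pval_neq0 x0).
by apply: pvalE => [|r]; rewrite pcoefN oppr_eq0 //; exact: omin.
Qed.

Lemma pvalM x y : pval (x * y)%R = pval x + pval y.
Proof.
have [->|x0] := eqVneq x 0%R.
  by rewrite mul0r pval0 addye // pval_neqNy.
have [->|y0] := eqVneq y 0%R.
  by rewrite mulr0 pval0 addey // pval_neqNy.
by rewrite !pval_neq0 ?mulf_neq0 // pordM // rmorphD.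
Qed.

Lemma pvalD x y : Order.min (pval x) (pval y) <= pval (x + y)%R.
Proof.
have [->|xy0] := eqVneq (x + y)%R 0%R; first by rewrite pval0 leey.
rewrite (pval_neq0 xy0) ge_min.
have [] := pordP xy0; rewrite pcoefD.
have [->|xq _ _] := eqVneq (x (pord (x + y)%R)) 0%R;
  last by rewrite pval_le_coef.
by rewrite add0r => yq _; rewrite (pval_le_coef yq) orbT.
Qed.

Lemma pval_sum_ge (I : Type) (r : seq I) (P : pred I) (F : I -> FF) m :
  (forall i, P i -> m <= pval (F i)) -> m <= pval (\sum_(i <- r | P i) F i)%R.
Proof.
move=> mF; elim/big_ind: _ => [|x y mx my|//]; first by rewrite pval0 leey.
by apply: le_trans (pvalD _ _); rewrite le_min mx my.
Qed.

Lemma pval_sum_gt (I : Type) (r : seq I) (P : pred I) (F : I -> FF) m :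
  m < +oo ->
  (forall i, P i -> m < pval (F i)) -> m < pval (\sum_(i <- r | P i) F i)%R.
Proof.
move=> my mF; elim/big_ind: _ => [|x y mx my'|//]; first by rewrite pval0.
by apply: lt_le_trans (pvalD _ _); rewrite lt_min mx my'.
Qed.

(* Two distinct bad scalars b, c for the same coordinate would force
   val (x + b y), val (x + c y) > min, hence val y > min and val x > min. *)
Lemma pvalD_nat_inj x y b c : (b < c)%N ->
  pval (x + b%:R * y)%R != Order.min (pval x) (pval y) ->
  pval (x + c%:R * y)%R != Order.min (pval x) (pval y) -> False.
Proof.
set m := Order.min _ _ => ltbc.
have natge k z : pval z <= pval (k%:R * z)%R.
  case: k => [|k]; first by rewrite mul0r pval0 leey.
  by rewrite pvalM pval_nat // add0e.
have gtm k : pval (x + k%:R * y)%R != m -> m < pval (x + k%:R * y)%R.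
  move=> nm; rewrite lt_neqAle eq_sym nm /=.
  apply: le_trans (pvalD _ _); rewrite le_min !ge_min lexx /=.
  by rewrite natge orbT.
move=> /gtm mb /gtm mc.
have my : m < pval y.
  have -> : pval y = pval ((c - b)%:R * y)%R.
    by rewrite pvalM pval_nat ?subn_gt0 // add0e.
  have -> : ((c - b)%:R * y = (x + c%:R * y) + - (x + b%:R * y))%R.
    by rewrite natrB ?(ltnW ltbc) // mulrBl opprD addrACA subrr add0r.
  by apply: lt_le_trans (pvalD _ _); rewrite lt_min mc pvalN.
have mx : m < pval x.
  have -> : x = ((x + b%:R * y) + - (b%:R * y))%R by rewrite addrK.
  apply: lt_le_trans (pvalD _ _); rewrite lt_min mb pvalN.
  exact: lt_le_trans (natge _ _).
by have := lexx m; rewrite {1}/m ge_min !leNgt mx my.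
Qed.

(** Pigeonhole: by [pvalD_nat_inj] each of the [n] coordinates spoils at most one scalar, so one of
    [0, ..., n] is good for all of them. *)
Lemma generic_pvalD n (v w : 'rV[FF]_n) : exists c : nat, forall j,
  pval (v ord0 j + c%:R * w ord0 j)%R =
  Order.min (pval (v ord0 j)) (pval (w ord0 j)).
Proof.
pose bad (c : nat) j := pval (v ord0 j + c%:R * w ord0 j)%R !=
  Order.min (pval (v ord0 j)) (pval (w ord0 j)).
apply: contrapT => /forallNP H.
have badP (c : 'I_n.+1) : exists j, bad c j.
  have /existsNP[j /eqP jc] := H c; by exists j.
have [f fP] := choice badP.
suff /leq_card : injective f by rewrite !card_ord ltnn.
have aux (b c : 'I_n.+1) : f b = f c -> ~~ (b < c)%N.
  move=> fbc; apply/negP => ltbc; apply: (pvalD_nat_inj ltbc (fP b)).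
  by rewrite fbc; exact: fP.
move=> b c fbc; apply: ord_inj.
by case: (ltngtP b c) (aux b c fbc) (aux c b (esym fbc)).
Qed.

Lemma generic_pval_bigmin n (P : {vspace 'rV[FF]_n}) k (v : 'I_k -> 'rV[FF]_n) :
  (forall i, v i \in P) ->
  exists2 u, u \in P & forall j, pval (u ord0 j) =
    \big[Order.min/+oo]_(i < k) pval (v i ord0 j).
Proof.
(* The enumeration of ['I_k] becomes an arbitrary list, on which induction adds one vector at a time
   with a generic scalar. *)
move=> vP; rewrite /index_enum; elim: (X in bigop _ X) => [|i s [u uP uE]].
  by exists 0%R; [exact: mem0v|move=> j; rewrite big_nil mxE pval0].
have [c cE] := generic_pvalD (v i) u.
exists (v i + c%:R *: u)%R; first by rewrite memvD ?memvZ.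
by move=> j; rewrite big_cons !mxE cE uE.
Qed.

End Valuation.

(** * Orthogonal complements for the bilinear form [dotF] *)

Section Orthogonal.
Variable n : nat.
Implicit Types (u v w : 'rV[FF]_n) (U P Q : {vspace 'rV[FF]_n}).

Lemma dotFC v w : dotF v w = dotF w v.
Proof. by apply: eq_bigr => i _; rewrite mulrC. Qed.

Lemma dotFDl u v w : dotF (u + v) w = dotF u w + dotF v w.
Proof. by rewrite -big_split; apply: eq_bigr => i _; rewrite mxE mulrDl. Qed.

Lemma dotFZl a v w : dotF (a *: v) w = a * dotF v w.
Proof. by rewrite mulr_sumr; apply: eq_bigr => i _; rewrite mxE mulrA. Qed.

Lemma dotF0l w : dotF 0 w = 0.
Proof. by rewrite -(scale0r 0) dotFZl mul0r. Qed.

Lemma dotF_suml (I : Type) (r : seq I) (F : I -> 'rV[FF]_n) w :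
  dotF (\sum_(i <- r) F i) w = \sum_(i <- r) dotF (F i) w.
Proof.
exact: (big_morph (fun v => dotF v w) (fun u v => dotFDl u v w) (dotF0l w)).
Qed.

Lemma dotF_delta i v : dotF (delta_mx ord0 i) v = v ord0 i.
Proof.
rewrite /dotF (bigD1 i) //= mxE !eqxx mul1r big1 ?addr0 // => k ki.
by rewrite mxE (negPf ki) andbF mul0r.
Qed.

Definition basis_mx U : 'M[FF]_(\dim U, n) :=
  \matrix_(k, j) (vbasis U)`_k ord0 j.

(** Encoded as a kernel so that rank-nullity computes its dimension. *)
Definition orthv U : {vspace 'rV[FF]_n} :=
  lker (linfun (mulmxr (basis_mx U)^T : 'rV[FF]_n -> 'rV[FF]_(\dim U))).

Lemma orthvP U v : reflect (forall u, u \in U -> dotF v u = 0) (v \in orthv U).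
Proof.
have rowE (k : 'I_(\dim U)) :
    (v *m (basis_mx U)^T) ord0 k = dotF v (vbasis U)`_k.
  by rewrite mxE; apply: eq_bigr => j _; rewrite !mxE.
rewrite memv_ker lfunE /=; apply: (iffP eqP) => [v0 u uU|v0].
  rewrite (coord_vbasis uU) dotFC dotF_suml big1 // => k _.
  by rewrite dotFZl dotFC -rowE v0 mxE mulr0.
apply/rowP => k; rewrite rowE mxE; apply: v0; apply: vbasis_mem.
by rewrite mem_nth // size_tuple.
Qed.

(** The rows of [basis_mx U] are independent, so it has a right inverse; the transpose of that
    inverse shows that the map with kernel [orthv U] is onto. *)
Lemma dim_orthv U : (\dim U + \dim (orthv U))%N = n.
Proof.
have /row_freeP[B' BB'] : row_free (basis_mx U).
  rewrite -kermx_eq0; apply/eqP/row_matrixP => i; rewrite row0.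
  have : row i (kermx (basis_mx U)) *m basis_mx U = 0.
    by rewrite -row_mul mulmx_ker row0.
  move: (row i _) => c cB; apply/rowP => k; rewrite mxE.
  have /freeP := basis_free (vbasisP U); apply.
  rewrite -[RHS]cB; apply/rowP => j; rewrite summxE !mxE.
  by apply: eq_bigr => l _; rewrite !mxE.
have := limg_ker_dim (linfun (mulmxr (basis_mx U)^T : 'rV[FF]_n -> _)) fullv.
rewrite capfv -/(orthv U) [X in (_ + \dim X)%N](_ : _ = fullv).
  by rewrite !dimvf /dim /= !mul1n addnC.
apply/vspaceP => z; rewrite memvf; apply/memv_imgP.
exists (z *m B'^T); first exact: memvf.
by rewrite lfunE /= -mulmxA -trmx_mul BB' trmx1 mulmx1.
Qed.

(** [P] is contained in [orthv Q] and has the same dimension, hence equals it. *)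
Lemma mem_complementary P Q v : complementary_subspaces P Q ->
  (forall w, w \in Q -> dotF v w = 0) -> v \in P.
Proof.
move=> [orthPQ dimPQ] /orthvP vQ.
have sub : (P <= orthv Q)%VS.
  by apply/subvP => u uP; apply/orthvP => w wQ; exact: orthPQ.
suff /eqP <- : orthv Q == P by [].
rewrite eq_sym -(dimv_leqif_eq sub); apply/eqP.
by apply: (@addnI (\dim Q)); rewrite dim_orthv addnC.
Qed.

Lemma complementary_sym P Q :
  complementary_subspaces P Q -> complementary_subspaces Q P.
Proof.
move=> [orthPQ dimPQ]; split; last by rewrite addnC.
by move=> v w vQ wP; rewrite dotFC orthPQ.
Qed.

Lemma complementary_orthv P : complementary_subspaces P (orthv P).
Proof.
split; last exact: dim_orthv.
by move=> v w vP /orthvP wP; rewrite dotFC wP.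
Qed.

End Orthogonal.

(** * Lifting a tropically orthogonal vector to an orthogonal one *)

Section TropicalLifting.
Variables (R : realType) (n : nat).
Local Open Scope ereal_scope.
Local Notation pval := (@pval R).
Implicit Types (P : {vspace 'rV[FF]_n}) (y : 'rV[\bar R]_n).

(* Induction on the dimension of P.  For x in P and b <> i minimising
   y_b + val x_b, a solution w for {z in P | z_b = 0} is corrected on
   coordinate b alone to become orthogonal to x. *)
Lemma orth_lift_coord P y i s : Rinfty R n y -> y ord0 i = (ratr s)%:E ->
  (forall x, x \in P ->
    (forall k, y ord0 k + pval (x ord0 k) = +oo) \/
    exists2 b, b != i & forall k,
      y ord0 b + pval (x ord0 b) <= y ord0 k + pval (x ord0 k)) ->
  exists w, [/\ forall x, x \in P -> dotF w x = 0%R,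
    forall k, y ord0 k <= pval (w ord0 k) & pval (w ord0 i) = y ord0 i].
Proof.
move=> yN yi; have [m] := ubnP (\dim P).
elim: m P => // m IHm P dimP HP.
have [Poo|] := pselect (forall x, x \in P ->
    forall k, y ord0 k + pval (x ord0 k) = +oo).
  (* Since [y] is finite at [i], every vector of [P] vanishes there, so a monomial placed at [i]
     alone is orthogonal to [P]. *)
  exists (pX _ s *: delta_mx ord0 i)%R; split=> [x xP|k|].
  - rewrite dotFZl dotF_delta; have [->|xi] := eqVneq (x ord0 i) 0%R.
      by rewrite mulr0.
    by have := Poo x xP i; rewrite yi pval_neq0.
  - rewrite !mxE /=; have [->|_] := eqVneq k i; first by rewrite mulr1 pvalX yi.
    by rewrite mulr0 pval0 leey.
  - by rewrite !mxE !eqxx mulr1 pvalX yi.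
move=> /existsNP[x] /existsNP[xP] /existsNP[k0 k0N].
have [/(_ k0)//|[b bi bmin]] := HP x xP.
have bfin : y ord0 b + pval (x ord0 b) < +oo.
  by apply: le_lt_trans (bmin k0) _; rewrite ltey; apply/eqP.
have xb0 : (x ord0 b != 0)%R.
  by apply: contraTneq bfin => ->; rewrite pval0 addey ?ltxx.
pose P' := (P :&: orthv <[delta_mx ord0 b : 'rV[FF]_n]>)%VS.
have memP' z : (z \in P') = (z \in P) && (z ord0 b == 0%R).
  rewrite memv_cap; congr andb; apply/orthvP/eqP => [H|zb u /vlineP[c ->]].
    by rewrite -dotF_delta dotFC H // memv_line.
  by rewrite dotFC dotFZl dotF_delta zb mulr0.
have [|z|w [wP' wy wi]] := IHm P'.
- rewrite -ltnS; apply: leq_trans dimP; rewrite ltnS.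
  have [le_d eq_d] : (\dim P' <= \dim P ?= iff (P <= P')%VS)%N.
    exact/dimv_leqif_sup/capvSl.
  rewrite ltn_neqAle le_d eq_d andbT; apply: contraL xP => /subvP sPP'.
  by apply: contraNN xb0 => /sPP'; rewrite memP' => /andP[].
- by rewrite memP' => /andP[zP _]; exact: HP.
pose c := (dotF w x / x ord0 b)%R.
(* Each term of [dotF w x] has valuation at least [y_k + val x_k], hence at least [y_b + val x_b];
   dividing by [x_b] leaves [y_b]. *)
have yc : y ord0 b <= pval c.
  have xbfin : pval (x ord0 b) \is a fin_num by rewrite pval_neq0.
  rewrite -(leeD2lE _ _ xbfin) -pvalM mulrC divfK // addeC.
  apply: pval_sum_ge => k _; rewrite pvalM; apply: le_trans (bmin k) _.
  by rewrite leeD2r.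
exists (w - c *: delta_mx ord0 b)%R; split=> [z zP|k|].
- rewrite dotFDl -scaleNr dotFZl dotF_delta.
  (* Subtracting the multiple of [x] that cancels coordinate [b] brings [z] into [P'], where [w] is
     already orthogonal. *)
  have := wP' (z - (z ord0 b / x ord0 b) *: x)%R.
  rewrite memP' memvB ?memvZ //= !mxE divfK // subrr eqxx => /(_ isT).
  rewrite dotFC dotFDl -scaleNr dotFZl mulNr => /eqP.
  rewrite subr_eq0 => /eqP zw; apply/eqP.
  by rewrite mulNr subr_eq0 dotFC zw dotFC /c mulrAC [eqbRHS]mulrC mulrA.
- rewrite !mxE /=; have [->|_] := eqVneq k b; last by rewrite mulr0 subr0.
  rewrite mulr1; apply: le_trans (pvalD _ _ _).
  by rewrite le_min wy pvalN.
- by rewrite !mxE /= eq_sym (negPf bi) mulr0 subr0.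
Qed.

Lemma trop_orth_lift P y : Qinfty R n y ->
  (forall x, x \in P -> trop_orth y (map_mx pval x)) ->
  exists2 w, lifting y w & forall x, x \in P -> dotF w x = 0%R.
Proof.
move=> yQ yP.
have yR : Rinfty R n y.
  by move=> i; case: (yQ i) => [->|[q ->]].
have : forall i, exists w, [/\ forall x, x \in P -> dotF w x = 0%R,
    forall k, y ord0 k <= pval (w ord0 k) & pval (w ord0 i) = y ord0 i].
  move=> i; case: (yQ i) => [yi|[s yi]].
    exists 0%R; split=> [x _|k|]; first by rewrite dotF0l.
      by rewrite mxE pval0 leey.
    by rewrite mxE pval0 yi.
  apply: (orth_lift_coord yR yi) => x /yP[H|[j [k [jk jmin kmin]]]].
    by left=> k; have := H k; rewrite mxE.
  (* Of two distinct minimising indices, at least one differs from [i]. *)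
  right; have [ji|ji] := eqVneq j i; [exists k|exists j] => //.
  - by rewrite -ji eq_sym.
  - by move=> l; have := kmin l; rewrite !mxE.
  - by move=> l; have := jmin l; rewrite !mxE.
move=> /choice[w wP].
have [|u /orthvP uP uE] := @generic_pval_bigmin R n (orthv P) n w.
  by move=> i; apply/orthvP; case: (wP i).
(* All the [w i] have valuation at least [y], and [w j] attains it at [j], so the coordinatewise
   minimum is exactly [y]. *)
exists u => // j; rewrite uE; apply/le_anti/andP; split.
  by have [_ _ <-] := wP j; apply: bigmin_le.
by apply: le_bigmin; [rewrite leey|move=> i _; case: (wP i)].
Qed.

End TropicalLifting.

(** * Approximation in [Trop], tropical orthogonality and hulls *)

Section Tropicalization.
Variables (R : realType) (n : nat).
Local Open Scope ereal_scope.
Local Notation pval := (@pval R).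
Implicit Types (P Q : {vspace 'rV[FF]_n}) (y a v : 'rV[\bar R]_n).

(** This removes the strata: for finite [e] the two bounds force [x] to vanish exactly where [y] is
    infinite, and on the other coordinates they express closeness in the sup norm. *)
Lemma TropP (X : set 'rV[FF]_n) y : Trop R X y <-> Rinfty R n y /\
  forall e : R, (0 < e)%R -> exists2 x, X x & forall i,
    pval (x ord0 i) <= y ord0 i + e%:E /\ y ord0 i <= pval (x ord0 i) + e%:E.
Proof.
split=> [[I [yI yfin clo]]|[yR yX]].
  split=> [i|e e0].
    have [/yI->//|/yfin] := boolP (i \in I).
    by rewrite fin_numE => /andP[].
  have [_ [[x [Xx DIx] <-] [_ xe]]] :=
    clo _ (nbhsx_ballx (coords_out I y) e e0).
  exists x => // i; have [iI|iI] := boolP (i \in I).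
    by move: (DIx i); rewrite iI => /eqP->; rewrite pval0 yI.
  have iI' : i \in ~: I by rewrite inE.
  have xi : (x ord0 i != 0)%R by rewrite DIx (negPf iI).
  have := xe ord0 (enum_rank_in iI' i).
  rewrite /ball /= !mxE enum_rankK_in // pval_neq0 //=.
  case: (y ord0 i) (yfin i iI) => [r _|//|//] /=.
  by rewrite ltr_norml -!EFinD !lee_fin => /andP[? ?]; split; lra.
pose I := [set i | y ord0 i == +oo]%SET.
have inI i : (i \in I) = (y ord0 i == +oo) by rewrite inE.
exists I; split=> [i|i|B /nbhs_ballP[e /= e0 eB]].
- by rewrite inI => /eqP.
- by rewrite inI fin_numE yR.
(* Halving turns the non-strict bounds into the strict ones defining the ball. *)
have e20 : (0 < e / 2)%R by rewrite divr_gt0.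
have [x Xx xe] := yX _ e20.
have DIx : Dstratum I x.
  move=> i; rewrite inI -(pval_eqy R).
  have [+ +] := xe i; case: (y ord0 i) (yR i) => [r| |] // _;
    by case: (pval (x ord0 i)) (pval_neqNy R (x ord0 i)).
exists (coords_out I (map_mx pval x)); split; first by exists x.
apply: eB; split=> // i k; rewrite !mxE.
have kI := enum_valP k; rewrite inE inI in kI.
have xk : (x ord0 (enum_val k) != 0)%R by rewrite DIx inI (negPf kI).
have [] := xe (enum_val k); rewrite pval_neq0 //.
case: (y ord0 (enum_val k)) (yR (enum_val k)) kI => [r| |] //= _ _.
rewrite -!EFinD !lee_fin => H1 H2; rewrite /ball /= ltr_norml.
by apply/andP; split; lra.
Qed.

Lemma Trop_map_pval (X : set 'rV[FF]_n) x : X x -> Trop R X (map_mx pval x).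
Proof.
move=> Xx; apply/TropP; split=> [i|e e0]; first by rewrite mxE pval_neqNy.
by exists x => // i; rewrite mxE leeDl // lee_fin ltW.
Qed.

Lemma trop_orth_sym v a : trop_orth v a -> trop_orth a v.
Proof.
move=> [H|[i [j [ij imin jmin]]]]; [left=> i|right; exists i, j; split=> // k].
- by rewrite addeC.
- by rewrite ![a _ _ + _]addeC.
- by rewrite ![a _ _ + _]addeC.
Qed.

Lemma not_trop_orth v a : ~ trop_orth v a -> exists2 i,
  v ord0 i + a ord0 i < +oo &
  forall k, k != i -> v ord0 i + a ord0 i < v ord0 k + a ord0 k.
Proof.
move=> /not_orP[/existsNP[i0 /eqP fi0] H].
case: (@arg_minP _ _ _ i0 predT (fun k => v ord0 k + a ord0 k) isT) => i _ imin.
exists i; first by apply: le_lt_trans (imin i0 isT) _; rewrite ltey.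
move=> k ki; rewrite ltNge; apply/negP => fk; apply: H.
exists i, k; split=> [|l|l]; first by rewrite eq_sym.
  exact: imin.
by apply: le_trans fk _; exact: imin.
Qed.

Lemma Trop_orth P Q v a : orthogonal_subspaces P Q ->
  Trop R [set` P] v -> Trop R [set` Q] a -> trop_orth v a.
Proof.
move=> orthPQ /TropP[vR vP] /TropP[aR aQ].
apply: contrapT => /not_trop_orth[i fi imin].
pose m := \big[Order.min/+oo]_(k < n | k != i) (v ord0 k + a ord0 k).
have [r rE] : exists r : R, v ord0 i + a ord0 i = r%:E.
  case: (v ord0 i) (a ord0 i) (vR i) (aR i) fi => [s| |] // [t| |] // _ _ _.
  by exists (s + t)%R.
(* Each factor is known up to [e], so each product up to [2 * e]: a gap above [4 * e] keeps the term
   at [i] strictly smallest. If [m] is infinite, any [e] serves. *)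
have [e e0 em] : exists2 e : R, (0 < e)%R & (r + 4 * e)%:E < m.
  have : r%:E < m by apply: lt_bigmin => [|k ki]; rewrite -rE ?imin.
  case: m => [s| |] //; last by exists 1%R; rewrite ?ltry.
  rewrite lte_fin => rs; exists ((s - r) / 8)%R; rewrite ?lte_fin; lra.
have [x xP xe] := vP _ e0; have [z zQ ze] := aQ _ e0.
have lei : pval (x ord0 i * z ord0 i)%R <= (r + 2 * e)%:E.
  have [xi _] := xe i; have [zi _] := ze i.
  rewrite pvalM; apply: le_trans (leeD xi zi) _.
  by rewrite addeACA rE -!EFinD lee_fin; lra.
have gtk k : k != i -> (r + 2 * e)%:E < pval (x ord0 k * z ord0 k)%R.
  move=> ki; have [_ xk] := xe k; have [_ zk] := ze k.
  have : (r + 4 * e)%:E < pval (x ord0 k * z ord0 k)%R + (2 * e)%:E.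
    apply: lt_le_trans em _; apply: (@le_trans _ _ (v ord0 k + a ord0 k)).
      exact: bigmin_le_cond.
    apply: le_trans (leeD xk zk) _.
    by rewrite addeACA -pvalM leeD2l // -EFinD lee_fin; lra.
  case: (pval _) (pval_neqNy R (x ord0 k * z ord0 k)%R) => [s| |] // _;
    last by move=> _; exact: ltry.
  by rewrite -EFinD !lte_fin; lra.
have := orthPQ _ _ xP zQ; rewrite /dotF (bigD1 i) //= => /eqP.
rewrite addr_eq0 => /eqP xzi; move: lei; rewrite leNgt => /negP[].
rewrite xzi pvalN.
exact: pval_sum_gt (ltry _) gtk.
Qed.

(** Hull coefficients may be irrational whereas finite valuations are rational, so density of the
    rationals is used. *)
Lemma approx_pval (t : \bar R) (e : R) : t != -oo -> (0 < e)%R ->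
  exists c : FF, t <= pval c /\ pval c <= t + e%:E.
Proof.
case: t => [r| |] // _ e0; last by exists 0%R; rewrite pval0 addye.
have [|q] := @rat_in_itvoo R r (r + e)%R; first by rewrite ltrDl.
rewrite in_itv /= => /andP[rq qre].
by exists (pX _ q); rewrite pvalX -EFinD !lee_fin !ltW.
Qed.

(** Replace each [t i] by a scalar of nearly that valuation and combine generically; the closure in
    [Trop] absorbs the error. *)
Lemma trophull_sub_Trop P k (y : 'I_k -> 'rV[\bar R]_n)
    (v : 'I_k -> 'rV[FF]_n) :
  (forall i, v i \in P) -> (forall i, lifting (y i) (v i)) ->
  trophull y `<=` Trop R [set` P].
Proof.
move=> vP vy _ [t [tN ->]].
have yN i j : y i ord0 j != -oo by rewrite -vy pval_neqNy.
apply/TropP; split=> [j|e e0].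
  rewrite mxE -ltNye; apply: lt_bigmin => // i _.
  by rewrite ltNye adde_eq_ninfty negb_or tN yN.
have [c cP] := choice (fun i => approx_pval (tN i) e0).
have [|u uP uE] := @generic_pval_bigmin R n P k (fun i => c i *: v i)%R.
  by move=> i; rewrite memvZ.
exists u => // j; rewrite mxE uE; split.
  elim/big_rec2: _ => [|i g f _ fg]; first by rewrite addye.
  rewrite mxE pvalM vy; have [_ ci] := cP i.
  case: (leP (t i + y i ord0 j) g) => _; rewrite ge_min; apply/orP.
    by left; rewrite addeAC leeD2r.
  by right.
apply: le_trans (leeDl _ _); last by rewrite lee_fin ltW.
apply: le_bigmin2 => i _; rewrite mxE pvalM vy leeD2r //.
by have [] := cP i.
Qed.

Lemma mem_trophull k (y : 'I_k -> 'rV[\bar R]_n) i :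
  (forall i, Rinfty R n (y i)) -> trophull y (y i).
Proof.
move=> yR; exists (fun l => if l == i then 0 else +oo); split=> [l|].
  by case: ifP.
apply/rowP => j; rewrite mxE (bigminD1 i) //= eqxx add0e.
apply/esym/min_idPl; apply: le_bigmin => [|l /negPf->]; rewrite ?leey //.
by rewrite addye ?leey // yR.
Qed.

Lemma Qinfty_sub_Rinfty : Qinfty R n `<=` Rinfty R n.
Proof. by move=> y yQ i; case: (yQ i) => [->|[q ->]]. Qed.

(** [A] lies in its double complement by symmetry of orthogonality, and complements reverse
    inclusions. *)
Lemma trop_perp3 (A : set 'rV[\bar R]_n) : A `<=` Rinfty R n ->
  trop_perp (trop_perp (trop_perp A)) `<=` trop_perp A.
Proof.
move=> AR v [vR vA]; split=> // a Aa; apply: vA; split; first exact: AR.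
by move=> w [_ wA]; apply/trop_orth_sym/wA.
Qed.

End Tropicalization.

(** * The cycle of implications between the three conditions *)

Theorem theorem3p1 (R : realType) (n p q : nat) (A : set 'rV[\bar R]_n)
  (x : 'I_p -> 'rV[\bar R]_n) (y : 'I_q -> 'rV[\bar R]_n)
  (finA : finite_set A) (QA : A `<=` Qinfty R n)
  (Qx : forall i, Qinfty R n (x i)) (Qy : forall j, Qinfty R n (y j))
  (Ax : trop_perp A = trophull x)
  (Ay : trop_perp (trop_perp A) = trophull y) :
  [<-> (exists P Q : {vspace 'rV[FF]_n},
          [/\ complementary_subspaces P Q,
              trop_perp A = Trop R [set` P] &
              trop_perp (trop_perp A) = Trop R [set` Q]]);
       (exists (v : 'I_p -> 'rV[FF]_n) (w : 'I_q -> 'rV[FF]_n),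
          [/\ forall i, lifting (x i) (v i),
              forall j, lifting (y j) (w j) &
              forall i j, dotF (v i) (w j) = 0]);
       trop_linear_variety (trop_perp A)].
Proof.
have xA i : trop_perp A (x i).
  by rewrite Ax; apply: mem_trophull => l; exact: Qinfty_sub_Rinfty.
have yA j : trop_perp (trop_perp A) (y j).
  by rewrite Ay; apply: mem_trophull => l; exact: Qinfty_sub_Rinfty.
(* Valuations of vectors of [P] lie in [trop_perp A], so each [y j] is tropically orthogonal to them
   and lifts. Both (1) => (2) and (3) => (1) use this. *)
have liftP (P : {vspace 'rV[FF]_n}) : trop_perp A = Trop R [set` P] ->
    forall j, exists w, lifting (y j) w /\ forall z, z \in P -> dotF w z = 0.
  move=> AP j; have [|w wy wP] := @trop_orth_lift R n P (y j) (Qy j).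
    move=> z zP; have [_] := yA j; apply.
    by rewrite AP; exact: Trop_map_pval.
  by exists w.
split; [|split].
- move=> [P [Q [PQ AP AQ]]].
  have [w wP] := choice (liftP P AP).
  have : forall i, exists v, lifting (x i) v /\ v \in P.
    move=> i; have [|v vx vQ] := @trop_orth_lift R n Q (x i) (Qx i).
      move=> z zQ; apply: trop_orth_sym.
      have : trop_perp (trop_perp A) (map_mx (@pval R) z).
        by rewrite AQ; exact: Trop_map_pval.
      by case=> _; apply.
    by exists v; split=> //; exact: mem_complementary PQ vQ.
  move=> /choice[v vP]; exists v, w; split=> [i|j|i j].
  + by have [] := vP i.
  + by have [] := wP j.
  + by rewrite dotFC; have [_] := wP j; apply; have [] := vP i.
- move=> [v [w [vx wy vw]]].
  pose Q := (\sum_j <[w j]>)%VS.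
  have [orthPQ _] := complementary_sym (complementary_orthv Q).
  exists (orthv Q); apply/seteqP; split=> z.
    rewrite Ax; apply: (trophull_sub_Trop _ vx) => i; apply/orthvP => u.
    move=> /memv_sumP[f fw ->]; rewrite dotFC dotF_suml big1 // => j _.
    by have /vlineP[c ->] := fw j isT; rewrite dotFZl dotFC vw mulr0.
  (* The lifts [w] put the double complement of [A] inside the tropicalization of [Q], to which [z]
     is tropically orthogonal; so [z] lies in the triple complement. *)
  move=> zQ; apply: trop_perp3; first exact/(subset_trans QA)/Qinfty_sub_Rinfty.
  split=> [|a]; first by have /TropP[] := zQ.
  rewrite Ay => ay; apply: (Trop_orth orthPQ zQ).
  apply: (trophull_sub_Trop _ wy) ay => j.
  by apply: (subvP (sumv_sup j _ (subvv _))); rewrite ?memv_line.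
- move=> [P AP]; exists P, (orthv P).
  have PQ := complementary_orthv P; have [orthPQ _] := PQ.
  split=> //; apply/seteqP; split=> z.
    (* The lifts of the generators [y j] lie in [orthv P], hence so does their hull tropically. *)
    have [w wP] := choice (liftP P AP).
    rewrite Ay; apply: (@trophull_sub_Trop _ _ _ _ _ w) => j.
      by apply/orthvP; have [] := wP j.
    by have [] := wP j.
  move=> zQ; split=> [|a]; first by have /TropP[] := zQ.
  by rewrite AP => aP; apply/trop_orth_sym; exact: Trop_orth orthPQ aP zQ.
Qed.
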